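(* Let $I = \langle \mathcal{N}, \mathcal{R}, L, \pi^0\rangle$ be a single-peaked instance with $n$ agents and $n$ resources. Then every allocation $\pi$ in $I$ that is stable with respect to swap-deals (i.e. $C_2(\pi) = \emptyset$) is also stable with respect to $C_n$ (i.e. $C_n(\pi)=\emptyset$).
   Context: Housing market: $\mathcal{N}=\{a_1,\dots,a_n\}$ is a set of $n$ agents and $\mathcal{R}=\{r_1,\dots,r_n\}$ a set of $n$ resources. An allocation $\pi=\langle \pi_{a_1},\dots,\pi_{a_n}\rangle$ is a bijective assignment of exactly one resource $\pi_{a_i}\in\mathcal{R}$ to each agent $a_i$. Each agent $a_i$ has a strict linear order $\succ_i$ over $\mathcal{R}$. An instance is $I=\langle \mathcal{N},\mathcal{R},L,\pi^0\rangle$ with $L=\langle \succ_i\mid a_i\in\mathcal{N}\rangle$ the preference profile and $\pi^0$ an initial allocation. For allocations, $\pi\succ_i\pi'$ means $\pi_{a_i}\succ_i\pi'_{a_i}$. Single-peakedness: a linear order $\succ$ over $\mathcal{R}$ with top-ranked element $top(\succ)$ is single-peaked with respect to an axis (linear order) $\lhd$ over $\mathcal{R}$ if for all $r,r'\in\mathcal{R}$, whenever $r'\lhd r\lhd top(\succ)$ or $top(\succ)\lhd r\lhd r'$, we have $r\succ r'$; and $top(\succ)$ is preferred to every other resource. An instance is single-peaked if there is an axis $\lhd$ such that all agents' preferences are single-peaked with respect to $\lhd$. Deals: a deal $\mu$ is a vector of $k\ge 1$ pairwise distinct agents, written (after renaming) $\mu=\langle a_1,\dots,a_k\rangle$; $|\mu|=k$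 is its size. Applying it to $\pi$ gives the allocation $\pi[\mu]$ in which each $a_i$ in $\mu$ receives $\pi_{a_{i-1}}$ (with $a_0:=a_k$) and all other agents keep their resources. The deal is improving (from $\pi$) if $\pi[\mu]\succ_i\pi$ for every agent $a_i$ involved in $\mu$. A swap-deal is a deal of size 2. $C_k(\pi)$ denotes the set of improving deals of size at most $k$ that can be applied from $\pi$, and $\pi$ is stable with respect to $C_k$ if $C_k(\pi)=\emptyset$. *)

(* Defs.v *)
From mathcomp Require Import all_boot.

Set Implicit Arguments.
Unset Strict Implicit.
Unset Printing Implicit Defensive.

Definition strict_linear_order (T : eqType) (r : rel T) : Prop :=
  [/\ irreflexive r, transitive r & forall x y, x != y -> r x y || r y x].

(* [p x y] reads "x is strictly preferred to y", [axis x y] reads "x lies to the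
   left of y". *)
Definition top_ranked (T : eqType) (p : rel T) (t : T) : Prop :=
  forall x, x != t -> p t x.

Definition single_peaked (T : eqType) (axis p : rel T) : Prop :=
  exists2 t, top_ranked p t &
    forall x y,
      (axis y x && axis x t) || (axis t x && axis x y) -> p x y.

Record allocation (A R : finType) := Allocation {
  alloc_fun :> A -> R;
  alloc_bij : bijective alloc_fun
}.

Record housing_market (n : nat) := HousingMarket {
  agent : finType;
  resource : finType;
  card_agent : #|agent| = n;
  card_resource : #|resource| = n;
  pref : agent -> rel resource;
  pref_linear : forall i, strict_linear_order (pref i);
  initial : allocation agent resource
}.

Definition single_peaked_market n (I : housing_market n) : Prop :=
  exists2 axis : rel (resource I), strict_linear_order axis &
    forall i, single_peaked axis (pref i).

Record deal (A : finType) := Deal {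
  deal_seq :> seq A;
  deal_uniq : uniq deal_seq;
  deal_size : 0 < size deal_seq
}.

Section Deals.
Variables (n : nat) (I : housing_market n).
Implicit Types (pi : allocation (agent I) (resource I)) (mu : deal (agent I)).

Fact deal_bij pi mu : bijective (fun i => pi (prev mu i)).
Proof.
apply: bij_comp (alloc_bij pi) _.
exact: Bijective (next_prev (deal_uniq mu)) (prev_next (deal_uniq mu)).
Qed.

(* [prev mu i] is the cyclic predecessor of [i] in [mu] if [i] occurs in [mu]
   (the first agent's predecessor being the last one), and [i] otherwise. *)
Definition apply_deal pi mu : allocation (agent I) (resource I) :=
  Allocation (deal_bij pi mu).

Definition prefers i pi pi' : bool := pref i (pi i) (pi' i).

Definition improving pi mu : bool :=
  all (fun i => prefers i (apply_deal pi mu) pi) mu.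

Definition improving_deals k pi : {pred deal (agent I)} :=
  [pred mu : deal (agent I) | (size mu <= k) && improving pi mu].

Definition stable k pi : Prop := improving_deals k pi =i pred0.

End Deals.

(* Main.v *)
(** On the axis, let [i] be the rightmost agent of an improving cycle who receives
    a resource to the right of her own, and [j] the next agent of the cycle to the
    right of [i].  Then [j] receives a resource at or to the left of that of [i],
    while [i] receives one at or to the right of that of [j], so by single-peakedness
    [i] and [j] both gain from swapping. *)
Require Import Defs.
From mathcomp Require Import all_boot.

Set Implicit Arguments.
Unset Strict Implicit.
Unset Printing Implicit Defensive.

Section StrictLinearOrder.
Variables (T : eqType) (lt : rel T).
Hypothesis lt_lin : strict_linear_order lt.

Lemma strict_linear_orderN x y : ~~ lt x y -> y = x \/ lt y x.
Proof.
case: lt_lin => _ _ tot; case: (eqVneq x y) => [->|/tot/orP[->|]]; by auto.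
Qed.

Lemma strict_linear_order_flip : strict_linear_order (fun x y => lt y x).
Proof.
case: lt_lin => irr tr tot; split=> // [y x z xy yz|x y neq]; first exact: tr xy.
by rewrite orbC tot.
Qed.

Lemma strict_linear_order_pre (S : eqType) (f : S -> T) :
  injective f -> strict_linear_order (fun x y => lt (f x) (f y)).
Proof.
case: lt_lin => irr tr tot f_inj; split=> [x|y x z|x y neq]; first exact: irr.
- exact: tr.
- by apply: tot; rewrite (inj_eq f_inj).
Qed.

Lemma exists_min (s : seq T) x0 :
  x0 \in s -> exists2 m, m \in s & forall x, x \in s -> ~~ lt x m.
Proof.
case: lt_lin => irr tr _.
elim: s x0 => // a [|b s] IHs x0 _.
  by exists a; rewrite ?mem_head // => x; rewrite inE => /eqP->; rewrite irr.
have [m ms m_min] := IHs b (mem_head _ _).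
have [am|am] := boolP (lt a m).
- exists a; rewrite ?mem_head // => x; rewrite inE => /orP[/eqP->|xs].
    by rewrite irr.
  by apply: contra (m_min x xs) => xa; apply: tr am.
- exists m; first by rewrite inE ms orbT.
  by move=> x; rewrite inE => /orP[/eqP->|/m_min].
Qed.

End StrictLinearOrder.

Lemma exists_max (T : eqType) (lt : rel T) (s : seq T) x0 :
  strict_linear_order lt -> x0 \in s ->
  exists2 m, m \in s & forall x, x \in s -> ~~ lt m x.
Proof. by move=> /strict_linear_order_flip/exists_min; apply. Qed.

Lemma exists_crossing (T : eqType) (lt : rel T) (s : seq T) (f : T -> T) x0 :
    strict_linear_order lt -> x0 \in s ->
    {in s, forall x, f x \in s} -> {in s, forall x, f x != x} ->
  exists i j, [/\ i \in s, j \in s, lt i j, ~~ lt (f i) j & ~~ lt i (f j)].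
Proof.
move=> lin x0s fs fneq; have [_ tr tot] := lin.
have [l ls l_min] := exists_min lin x0s.
(* The leftmost entry of [s] is moved by [f] within [s], hence to the right; so some entry moves
   right and a rightmost such [i] exists. *)
have l_up : l \in [seq x <- s | lt x (f x)].
  rewrite mem_filter ls andbT.
  by have := tot _ _ (fneq l ls); rewrite (negPf (l_min _ (fs _ ls))).
have [i] := exists_max lin l_up.
rewrite mem_filter => /andP[i_up is_] i_max.
have fi_right : f i \in [seq x <- s | lt i x] by rewrite mem_filter i_up fs.
have [j] := exists_min lin fi_right.
rewrite mem_filter => /andP[ij js] j_min.
exists i, j; split=> //; first exact: j_min.
(* As [j] is right of [i], the maximality of [i] forbids [j] to move right, and [j] is not fixed. *)
have j_down : lt (f j) j.
  have : ~~ lt j (f j).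
    by apply: contraL ij => j_up; apply: i_max; rewrite mem_filter j_up.
  by case/(strict_linear_orderN lin) => // e; have := fneq j js; rewrite e eqxx.
(* If [f j] were right of [i], it would compete with [j] in the choice of the leftmost entry beyond
   [i], so it could not lie left of [j]. *)
by apply: contraL j_down => ifj; apply: j_min; rewrite mem_filter ifj fs.
Qed.

Section SinglePeaked.
Variables (T : eqType) (axis p : rel T).

Lemma single_peaked_flip :
  single_peaked axis p -> single_peaked (fun x y => axis y x) p.
Proof.
case=> t ht peak; exists t => // x y h; apply: peak.
by rewrite orbC andbC [X in _ || X]andbC.
Qed.

Hypotheses (axis_lin : strict_linear_order axis) (p_lin : strict_linear_order p).
Hypothesis peaked : single_peaked axis p.

(** Compare [b] with the peak [t]. If [b] is left of [t], then going from [a] to [b] approaches the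
    peak. If it is right of [t], then [b] lies between [t] and [c], so it beats [c], which beats
    [a]. *)
Lemma single_peaked_between a b c :
  axis a b -> ~~ axis c b -> p c a -> p b a.
Proof.
have [irr tr tot] := axis_lin; have [_ ptr _] := p_lin; have [t ht peak] := peaked.
move=> ab cb ca; case: (strict_linear_orderN axis_lin cb) => [->//|bc].
case: (eqVneq b t) => [bt|/tot/orP[lt_bt|lt_tb]].
- by rewrite bt; apply: ht; apply: contraTneq ab => ->; rewrite bt irr.
- by apply: peak; rewrite ab lt_bt.
- by apply: ptr ca; apply: peak; rewrite lt_tb bc orbT.
Qed.

End SinglePeaked.

Theorem theorem1 (n : nat) (I : housing_market n) (hI : single_peaked_market I)
    (pi : allocation (agent I) (resource I)) (hpi : stable 2 pi) :
  stable n pi.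
Proof.
case: hI => axis axis_lin peaked mu; rewrite [RHS]inE; apply/negP.
rewrite inE => /andP[_ /allP mu_impr].
have [x0 x0mu] : exists x, x \in deal_seq mu.
  by case: (deal_seq mu) (deal_size mu) => // x s _; exists x; rewrite mem_head.
have pi_inj := bij_inj (alloc_bij pi).
(* An agent who is her own predecessor would keep her resource, which is no strict gain; this also
   excludes deals of size one. *)
have prev_neq : {in deal_seq mu, forall x, prev mu x != x}.
  move=> x /mu_impr; apply: contraTneq; rewrite /prefers /= => ->.
  by case: (pref_linear x) => ->.
have prev_in : {in deal_seq mu, forall x, prev mu x \in deal_seq mu}.
  by move=> x; rewrite mem_prev.
(* Agents are ordered by the axis position of the resources they own under [pi]; [prev mu i] is the
   owner of what [i] receives. *)
have [i [j [imu jmu ij i_up j_down]]] :=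
  exists_crossing (strict_linear_order_pre axis_lin pi_inj) x0mu prev_in prev_neq.
have i_gain : pref i (pi j) (pi i).
  exact: (single_peaked_between axis_lin (pref_linear i) (peaked i) ij i_up
            (mu_impr i imu)).
(* The mirror image of the gain of [i]: on the reversed axis [j] comes first. *)
have j_gain : pref j (pi i) (pi j).
  exact: (single_peaked_between (strict_linear_order_flip axis_lin)
    (pref_linear j) (single_peaked_flip (peaked j)) ij j_down (mu_impr j jmu)).
have neq_ij : i != j.
  by apply: contraTneq ij => ->; case: axis_lin => ->.
have uniq_ij : uniq [:: i; j] by rewrite /= inE neq_ij.
have := hpi (@Deal _ [:: i; j] uniq_ij isT).
rewrite !inE /improving /prefers /= !eqxx.
by rewrite (negPf neq_ij) i_gain j_gain.
Qed.
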